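(* Let $G$ be a finite group. If $d^*(G)>\frac{9}{59}=d^*(A_5)=d'(A_5)$, then $G$ is solvable. (That is: $d^*(A_5)=d'(A_5)=\frac{9}{59}$, and every finite group $G$ with $d^*(G)>\frac{9}{59}$ is solvable.)
   Context: For a finite group $G$, let $L(G)$ denote the set (lattice) of all subgroups of $G$, and let $k'(G)$ denote the number of conjugacy classes of subgroups of $G$ (i.e. the number of orbits of $G$ acting on $L(G)$ by conjugation). Define $d'(G)=\frac{k'(G)}{|L(G)|}$. A section of $G$ is a quotient group $H/N$, where $H,N$ are subgroups of $G$ and $N$ is a normal subgroup of $H$. Define $d^*(G)=\min\{d'(S)\mid S \text{ is a section of } G\}$. $A_5$ is the alternating group of degree 5. *)

(* Defs.v *)
From mathcomp Require Import all_boot all_order all_algebra all_fingroup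
  all_solvable.

Set Implicit Arguments.
Unset Strict Implicit.
Unset Printing Implicit Defensive.

Import Order.TTheory GRing.Theory Num.Theory GroupScope.

Section Degree.

Variable gT : finGroupType.
Implicit Type G : {group gT}.

Definition subgroup_classes G : {set {set {group gT}}} :=
  orbit 'JG G @: subgroups G.

Definition kprime G : nat := #|subgroup_classes G|.

Definition dprime G : rat := ((kprime G)%:R / #|subgroups G|%:R)%R.

End Degree.

Section SectionMin.

Variable gT : finGroupType.
Implicit Types G H N : {group gT}.

(* The pair HN stands for the section HN.1 / HN.2 of G. *)
Definition is_section G (HN : {group gT} * {group gT}) : bool :=
  (HN.1 \subset G) && (HN.2 <| HN.1).

Definition dprime_section (HN : {group gT} * {group gT}) : rat :=
  dprime (HN.1 / HN.2)%G.

(* [arg min] yields a minimizer; the pair (G, 1) only witnesses that G has a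
   section. *)
Definition dstar G : rat :=
  dprime_section
    [arg min_(HN < (G, 1%G) | is_section G HN) dprime_section HN]%O.

Lemma is_section_triv G : is_section G (G, 1%G).
Proof. by rewrite /is_section /= subxx normal1. Qed.

Lemma dstar_min G H N :
  H \subset G -> N <| H -> (dstar G <= dprime (H / N)%G)%R.
Proof.
move=> sHG nNH; rewrite /dstar.
case: arg_minP => [|HN _ minHN]; first exact: is_section_triv.
by apply: (minHN (H, N)); rewrite /is_section sHG.
Qed.

Lemma dstar_attained G :
  exists H N, [/\ H \subset G, N <| H & dstar G = dprime (H / N)%G].
Proof.
rewrite /dstar; case: arg_minP => [|[H N] /andP[sHG nNH] _].
  exact: is_section_triv.
by exists H, N.
Qed.

End SectionMin.

(* Main.v *)
(** Since the conjugacy classes of subgroups partition L(G), the inequality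
    d'(G) <= 9/59 says that the sum of 9 c - 59 over the class sizes c is
    nonnegative.  The classes of 1 and G contribute -100.  A nonsolvable group
    has a simple section S all of whose proper subgroups are solvable.  If every
    proper subgroup of S has index at least 7, all other classes contribute
    positively, and Burnside's p^a q^b theorem provides Sylow subgroups for
    three primes; Sylow's congruences make their classes large enough.
    Otherwise S acts faithfully on at most 6 cosets, so that it lies in Alt_5 or
    Alt_6, and then |S| = 60.  In a simple group of order 60 the classes have
    sizes 1, 15, 10, 5, 6, 10, 6, 5, 1, which gives 9/59 exactly.  No
    classification of minimal simple groups is needed. *)

Require Import Defs.
From mathcomp Require Import all_boot all_order all_algebra all_fingroup
  all_solvable.
From mathcomp Require Import integral_char zify.

Set Implicit Arguments.
Unset Strict Implicit.
Unset Printing Implicit Defensive.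

Import Order.TTheory GRing.Theory Num.Theory GroupScope.

(** * Classes of subgroups *)

Section SubgroupClasses.

Variables (gT : finGroupType) (G : {group gT}).
Implicit Types (A H : {group gT}) (s t : seq {group gT}).

Lemma card_subgroup_class A : #|orbit 'JG G A| = #|G : 'N_G(A)|.
Proof. by rewrite card_orbit astab1JG. Qed.

Lemma card_in_class A H : H \in orbit 'JG G A -> #|H| = #|A|.
Proof. by case/orbitP=> x _ <-; rewrite cardJg. Qed.

Lemma sum_card_subgroup_classes :
  \sum_(O in subgroup_classes G) #|O| = #|subgroups G|.
Proof.
rewrite /subgroup_classes; apply: acts_sum_card_orbit.
apply/actsP=> x Gx H; rewrite !inE /= -{1}(conjGid Gx) conjSg //.
Qed.

(** Conjugate subgroups have the same order, so distinct orders certify distinct classes. The lists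
    of representatives below are all separated this way. *)
Lemma uniq_classes_of_orders s :
  uniq [seq #|A| | A : {group gT} <- s] -> uniq [seq orbit 'JG G A | A <- s].
Proof.
elim: s => //= A s IHs /andP[notAs /IHs->]; rewrite andbT.
apply: contra notAs => /mapP[B sB eqAB].
apply/mapP; exists B => //; apply: card_in_class.
by rewrite -eqAB orbit_refl.
Qed.

Lemma sum_orbits s :
  uniq [seq orbit 'JG G A | A <- s] ->
  \sum_(O in [set:: [seq orbit 'JG G A | A <- s]]) #|O|
    = \sum_(A <- s) #|G : 'N_G(A)|.
Proof.
move=> Us; rewrite (eq_bigl (mem [seq orbit 'JG G A | A <- s])) => [|O].
  rewrite -big_uniq // big_map; apply: eq_bigr => A _.
  exact: card_subgroup_class.
by rewrite inE.
Qed.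

Lemma size_le_kprime s :
    {in s, forall A, A \subset G} ->
    uniq [seq #|A| | A : {group gT} <- s] ->
  size s <= kprime G.
Proof.
move=> sG /uniq_classes_of_orders Us; rewrite -(size_map (orbit 'JG G)).
rewrite -(card_uniqP Us) /kprime.
apply/subset_leq_card/subsetP=> _ /mapP[A sA ->].
by apply: imset_f; rewrite inE sG.
Qed.

Lemma subgroup_classes_transversal t :
    {in t, forall A, A \subset G} ->
    uniq [seq #|A| | A : {group gT} <- t] ->
    (forall H, H \subset G -> exists2 A, A \in t & H \in orbit 'JG G A) ->
  kprime G = size t /\ #|subgroups G| = \sum_(A <- t) #|G : 'N_G(A)|.
Proof.
move=> tG /uniq_classes_of_orders Ut tP.
have defC: subgroup_classes G = [set:: [seq orbit 'JG G A | A <- t]].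
  apply/setP=> O; rewrite inE; apply/imsetP/mapP=> [[H]|[A tA ->]].
    rewrite inE => /tP[A tA /orbit_eqP eqHA] ->; by exists A.
  by exists A; rewrite // inE tG.
split; last by rewrite -sum_card_subgroup_classes defC sum_orbits.
by rewrite /kprime defC cardsE (card_uniqP Ut) size_map.
Qed.

(* A class of size c contributes 9 c - 59 to 9 |L(G)| - 59 k'(G). *)
Lemma kprime_le_weight s :
    (forall A, A \subset G -> A :!=: 1 -> A :!=: G -> 6 < #|G : 'N_G(A)|) ->
    {in s, forall A, A \subset G} -> G :!=: 1 ->
    uniq [:: 1%N, #|G| & [seq #|A| | A : {group gT} <- s]] ->
    59 * (size s).+2 <= 9 * (2 + \sum_(A <- s) #|G : 'N_G(A)|) ->
  59 * kprime G <= 9 * #|subgroups G|.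
Proof.
move=> minG sG ntG Us le_s; pose t := [:: 1%G, G & s].
have Ut: uniq [seq orbit 'JG G A | A <- t].
  by apply: uniq_classes_of_orders; rewrite /= cards1.
set C0 := [set:: [seq orbit 'JG G A | A <- t]].
have sC0: C0 \subset subgroup_classes G.
  apply/subsetP=> O; rewrite inE => /mapP[A tA ->]; apply: imset_f.
  move: tA; rewrite !inE => /or3P[/eqP->|/eqP->|/sG//]; first exact: sub1G.
  exact: subxx.
(* Both sides become sums over classes, split along [C0]: the listed classes are compared in total
   by [le_s], the others one by one, a class of size at least 7 giving 9 * 7 = 63 against 59. *)
rewrite -sum_card_subgroup_classes /kprime -sum1_card !big_distrr /=.
rewrite (big_setID C0) [X in _ <= X](big_setID C0) /= (setIidPr sC0).
apply: leq_add.
  rewrite -!big_distrr sum1_card /= sum_orbits //.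
  rewrite cardsE (card_uniqP Ut) size_map /t !big_cons /=.
  have -> : 'N_G(1) = G by rewrite norm1 setIT.
  have -> : 'N_G(G) = G by apply/setIidPl/normG.
  by rewrite indexgg addnA.
apply: leq_sum => O; rewrite inE => /andP[notC0 /imsetP[A]].
rewrite inE => sAG defO; rewrite defO card_subgroup_class.
suffices: 6 < #|G : 'N_G(A)| by lia.
apply: minG => //; apply: contraNneq notC0 => eqA; rewrite inE defO;
  rewrite (group_inj eqA); apply: map_f; rewrite !inE eqxx ?orbT //.
Qed.

End SubgroupClasses.

(** * Simple groups acting on cosets *)

Section SimpleAction.

Variables (gT : finGroupType) (G H : {group gT}).
Hypotheses (simpleG : simple G) (prHG : H \proper G).

(** The kernel of the action on the right cosets of [H] is normal, hence trivial or [G]; in the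
    latter case an [x] outside [H] would fix the coset [H]. *)
Lemma simple_injm_perm :
  exists T : finType, exists2 f : {morphism G >-> {perm T}},
    'injm f & #|T| = #|G : H|.
Proof.
pose cosets : finType := {A : {set gT} | A \in rcosets H G}.
exists cosets.
pose to := ('Rs ^? : action (subact_dom (mem (rcosets H G)) 'Rs) cosets)%act.
have sGD : G \subset subact_dom (mem (rcosets H G)) 'Rs.
  have := actsRs_rcosets H G; congr (G \subset 'N(_ | _)).
  by apply/setP=> A; rewrite inE.
pose f := restrm_morphism sGD (actperm_morphism to).
exists f; last by rewrite card_sub.
have /simpleP[_ simG] := simpleG.
have [/trivgP//|defK] := simG _ (ker_normal f).
case/properP: prHG => _ [x Gx /negP[]].
have: x \in 'ker f by rewrite defK.
rewrite ker_restrm => /setIP[_ /kerP-/(_ (subsetP sGD _ Gx))/= x1].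
have HG : H :* 1 \in rcosets H G by apply/rcosetsP; exists 1.
have := congr1 (fun p : {perm cosets} => val (p (Sub (H :* 1) HG))) x1.
rewrite actpermE perm1 val_subact (subsetP sGD _ Gx) /= rcosetE rcoset1 => HxE.
by have := rcoset_refl H x; rewrite HxE.
Qed.

Lemma simple_dvd_index_fact : #|G| %| #|G : H| `!.
Proof.
have [T [f injf <-]] := simple_injm_perm.
by rewrite -card_Sym -(card_injm injf) // cardSg ?subsetT.
Qed.

End SimpleAction.

(** ['Alt_T :&: K] is normal in [K]. If it were trivial, [K] would embed in the quotient of ['Sym_T]
    by ['Alt_T], which has order at most 2. *)
Lemma simple_subset_Alt (T : finType) (K : {group {perm T}}) :
  simple K -> 2 < #|K| -> K \subset 'Alt_T.
Proof.
move=> simK ltK; have sKS : K \subset 'Sym_T by apply: subsetT.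
have nAK := subset_trans sKS (Alt_norm T).
have nsA : 'Alt_T :&: K <| K by rewrite /normal subsetIr normsI ?normG.
have /simpleP[_ simK'] := simK.
have [A1|defK] := simK' _ nsA; last by apply/setIidPr.
have [lt1|le1] := ltnP 1 #|T|; last first.
  have := leq_trans ltK (subset_leq_card sKS).
  by rewrite card_Sym; case: #|T| le1 => [|[]].
have := card_isog (second_isog nAK).
rewrite /= A1 -(card_isog (quotient1_isog _)) => eqc; move: ltK.
rewrite eqc ltnNge -(Alt_index lt1) -card_quotient ?Alt_norm //.
by rewrite subset_leq_card ?quotientS.
Qed.

Lemma prime_dvd_fact p n : prime p -> p %| n`! -> p <= n.
Proof.
move=> p_pr; elim: n => [|n IHn].
  by rewrite dvdn1 => /eqP p1; rewrite p1 in p_pr.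
rewrite factS Euclid_dvdM // => /orP[/dvdn_leq->//|/IHn/leqW//].
Qed.

(** * Sylow subgroups and families of subgroups with trivial intersections *)

Section Sylow.

Variable gT : finGroupType.
Implicit Types (A B G H P Q : {group gT}) (F : {set {group gT}}).

Lemma mem_class_conj G A H x : x \in G -> H :=: A :^ x -> H \in orbit 'JG G A.
Proof. by move=> Gx defH; apply/orbitP; exists x => //; apply: val_inj. Qed.

(** [P] is the p-core of its normalizer, hence characteristic there, so whatever normalizes
    ['N_G(P)] normalizes [P]. *)
Lemma norm_norm_Sylow p G P :
  p.-Sylow(G) P -> 'N_G('N_G(P)) = 'N_G(P).
Proof.
move=> sylP; apply/eqP; rewrite eqEsubset; apply/andP; split; last first.
  by rewrite subsetI subsetIl normG.
rewrite subsetI subsetIl /=.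
have sPN : P \subset 'N_G(P) by rewrite subsetI normG (pHall_sub sylP).
have sylPN := pHall_subl sPN (subsetIl G _) sylP.
have nsPN : P <| 'N_G(P) by rewrite normal_subnorm (pHall_sub sylP).
apply: subset_trans (subsetIr G _) _.
have := char_norms (pcore_char p 'N_G(P)%G).
by rewrite /= (normal_Hall_pcore sylPN nsPN).
Qed.

Lemma card_bigcup_TI F m :
    {in F, forall A, #|A| = m} -> 1 < m ->
    {in F &, forall A B, A != B -> A :&: B = 1} ->
  #|\bigcup_(A in F) A^#| = (#|F| * m.-1)%N.
Proof.
move=> oF lt1m tiF; pose D (A : {group gT}) := A^#.
have oD A : A \in F -> #|D A| = m.-1.
  by move=> FA; rewrite -(oF A FA) (cardsD1 1 A) group1.
have [||tiD injD] := @trivIimset _ _ (mem F) D.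
- move=> A B FA FB neqBA; rewrite -setI_eq0 -setDIl tiF ?setDv //.
  by rewrite eq_sym.
(* Since 1 < m, no [A^#] is empty; this makes [D] injective on [F]. *)
- apply/imsetP=> [[A FA /esym/eqP]]; rewrite -cards_eq0 oD //.
  by case: m lt1m {oF oD} => [|[]].
have := eqP tiD; rewrite /cover !big_imset //= => <-.
by rewrite -sum_nat_const; apply: eq_bigr => A /oD.
Qed.

(** Nontrivial elements are counted: members of one family meet trivially by hypothesis, members of
    different families by coprimality. The inequality is strict because the identity is left out. *)
Lemma ltn_card_TI_families G F1 F2 m1 m2 :
    {in F1, forall A, A \subset G} -> {in F2, forall A, A \subset G} ->
    {in F1, forall A, #|A| = m1} -> {in F2, forall A, #|A| = m2} ->
    1 < m1 -> 1 < m2 -> coprime m1 m2 ->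
    {in F1 &, forall A B, A != B -> A :&: B = 1} ->
    {in F2 &, forall A B, A != B -> A :&: B = 1} ->
  #|F1| * m1.-1 + #|F2| * m2.-1 < #|G|.
Proof.
move=> sF1 sF2 oF1 oF2 lt1 lt2 co12 ti1 ti2.
have ti12: (\bigcup_(A in F1) A^#) :&: (\bigcup_(A in F2) A^#) = set0.
  apply/setP=> x; rewrite !inE.
  apply/andP=> [[/bigcupP[A FA + ] /bigcupP[B FB]]].
  move=> /setD1P[nx1 Ax] /setD1P[_ Bx]; case/eqP: nx1; apply/set1P.
  rewrite -[[set 1]](@coprime_TIg _ A B) ?inE ?Ax //.
  by rewrite (oF1 A FA) (oF2 B FB).
rewrite -(card_bigcup_TI oF1) // -(card_bigcup_TI oF2) //.
rewrite -cardsUI ti12 cards0 addn0.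
rewrite [#|G|](cardsD1 1) group1 ltnS subset_leq_card // subUset.
by apply/andP; split; apply/bigcupsP=> A FA; apply: setSD;
  [apply: sF1 | apply: sF2].
Qed.

Lemma TI_prime_card A B : prime #|A| -> #|A| = #|B| -> A != B -> A :&: B = 1.
Proof.
move=> p_pr oAB neqAB; apply: prime_TIg p_pr _.
by apply: contra neqAB => sAB; rewrite -val_eqE eqEcard sAB oAB /=.
Qed.

Lemma Sylow_exists_sub (p : nat) G H :
    H \subset G -> (#|H|`_p)%N = (#|G|`_p)%N ->
  exists2 P : {group gT}, p.-Sylow(H) P & p.-Sylow(G) P.
Proof.
move=> sHG eqp; have [P sylP] := Sylow_exists p H; exists P => //.
rewrite pHallE (subset_trans (pHall_sub sylP)) //=.
by rewrite (card_Hall sylP) eqp.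
Qed.

End Sylow.

(** * Indices and Sylow numbers in nonsolvable simple groups *)

Section SimpleIndex.

Variables (gT : finGroupType) (G : {group gT}).
Hypotheses (simpleG : simple G) (nsolG : ~~ solvable G).
Implicit Types (H P : {group gT}).

Lemma nsol_third_prime q r : exists p, [/\ prime p, p %| #|G|, p != q & p != r].
Proof.
have : ~~ all [in [:: q; r]] (primes #|G|).
  apply: contra nsolG => /allP sub; apply: Burnside_p_a_q_b.
  exact: uniq_leq_size (primes_uniq _) sub.
case/allPn=> p; rewrite mem_primes !inE negb_or => /and3P[p_pr _ pG] /andP[].
by exists p.
Qed.

Lemma nsol_three_primes n : #|G| %| n -> 0 < n -> 2 < size (primes n).
Proof.
move=> dvG n_gt0; apply: contraR nsolG; rewrite -leqNgt => le2.
apply: Burnside_p_a_q_b; apply: leq_trans le2.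
apply: uniq_leq_size (primes_uniq _) _ => p.
rewrite !mem_primes n_gt0 => /and3P[-> _ pG]; exact: dvdn_trans dvG.
Qed.

(** The order of [G] divides the factorial of the index and has three prime divisors by Burnside,
    while k! for k at most 4 involves only 2 and 3. *)
Lemma proper_index_ge5 H : H \proper G -> 4 < #|G : H|.
Proof.
move=> /(simple_dvd_index_fact simpleG); rewrite ltnNge => dvG.
apply/negP=> le4; have := nsol_three_primes dvG (fact_gt0 _).
by have := indexg_gt0 G H; move: #|G : H| le4 => [|[|[|[|[]]]]].
Qed.

Lemma prime_le_index H p : H \proper G -> prime p -> p %| #|G| -> p <= #|G : H|.
Proof.
move=> /(simple_dvd_index_fact simpleG) dvG p_pr pG.
exact: prime_dvd_fact (dvdn_trans pG dvG).
Qed.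

Lemma norm_proper_simple H :
  H \subset G -> H :!=: 1 -> H :!=: G -> 'N_G(H) \proper G.
Proof.
move=> sHG ntH neqHG; rewrite properE subsetIl; apply/negP=> sGN.
have nsHG : H <| G by rewrite /normal sHG (subset_trans sGN) ?subsetIr.
by have /simpleP[_ /(_ _ nsHG)[] eqH] := simpleG; rewrite eqH eqxx in ntH neqHG.
Qed.

Lemma Sylow_nontriv_proper p P : prime p -> p %| #|G| -> p.-Sylow(G) P ->
  [/\ P \subset G, P :!=: 1 & P :!=: G].
Proof.
move=> p_pr pG sylP; split; first exact: pHall_sub sylP.
  by rewrite -rank_gt0 (rank_Sylow sylP) p_rank_gt0 mem_primes p_pr cardG_gt0.
apply: contraNneq nsolG => defP.
by rewrite -defP; apply: pgroup_sol (pHall_pgroup sylP).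
Qed.

Lemma norm_Sylow_proper p P : prime p -> p %| #|G| -> p.-Sylow(G) P ->
  'N_G(P) \proper G.
Proof.
by move=> p_pr pG /(Sylow_nontriv_proper p_pr pG)[]; apply: norm_proper_simple.
Qed.

(** Sylow numbers are indices of proper subgroups, so the index bounds apply to them. *)
Lemma card_Syl_proper p : prime p -> p %| #|G| ->
  exists2 P : {group gT}, p.-Sylow(G) P &
    #|'Syl_p(G)| = #|G : 'N_G(P)| /\ 'N_G(P) \proper G.
Proof.
move=> p_pr pG; have [P sylP] := Sylow_exists p G; exists P => //.
by rewrite (card_Syl sylP) (norm_Sylow_proper p_pr pG sylP).
Qed.

End SimpleIndex.

(** Turns a case analysis on the divisors of a numeral into a computation. *)
Lemma all_divisorsP n (a : pred nat) m :
  m %| n -> 0 < n -> all a (divisors n) -> a m.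
Proof. by move=> dv n_gt0 /allP; apply; rewrite -dvdn_divisors. Qed.

Lemma simple60_nsol (gT : finGroupType) (G : {group gT}) :
  simple G -> #|G| = 60 -> ~~ solvable G.
Proof.
by move=> simG oG; apply/negP=> /simple_sol_prime/(_ simG); rewrite oG.
Qed.

(** * Simple groups of order 60 *)

Section Order60.

Variables (gT : finGroupType) (G : {group gT}).
Hypotheses (simpleG : simple G) (oG : #|G| = 60).
Implicit Types (H K M P Q S T X Y : {group gT}).

Let nsolG := simple60_nsol simpleG oG.

Lemma proper60_card H : H \proper G -> #|H| \in [:: 1; 2; 3; 4; 5; 6; 10; 12]%N.
Proof.
move=> prH; have ge5 := proper_index_ge5 simpleG nsolG prH.
have LG := Lagrange (proper_sub prH).
have dvH : #|H| %| 60 by rewrite -oG -LG dvdn_mulr.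
have le12 : #|H| <= 12 by rewrite oG in LG; nia.
apply: implyP le12.
exact: (all_divisorsP (a := fun m => (m <= 12) ==> (m \in _)) dvH).
Qed.

(** The Sylow number divides 60, is 1 modulo p and exceeds 4; [a] states what a computation extracts
    from these constraints. *)
Lemma card_Syl60_divisor p (a : pred nat) : p \in primes 60 ->
    all (fun n => (n %% p == 1%N) && (4 < n) ==> a n) (divisors 60) ->
  a #|'Syl_p(G)|.
Proof.
rewrite mem_primes => /and3P[p_pr _ p60] all_a.
have pG : p %| #|G| by rewrite oG.
have [P sylP [nP prN]] := card_Syl_proper simpleG nsolG p_pr pG.
have dv : #|'Syl_p(G)| %| 60 by rewrite -oG card_Syl_dvd.
have := all_divisorsP dv isT all_a.
rewrite card_Syl_mod // eqxx /= nP (proper_index_ge5 simpleG nsolG prN) //.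
Qed.

Lemma card_Syl60_3 : #|'Syl_3(G)| = 10.
Proof. exact/eqP/(@card_Syl60_divisor 3 (pred1 10)). Qed.

Lemma card_Syl60_5 : #|'Syl_5(G)| = 6.
Proof. exact/eqP/(@card_Syl60_divisor 5 (pred1 6)). Qed.

Lemma card_Sylow60 p P : p.-Sylow(G) P -> #|P| = (60`_p)%N.
Proof. by move/card_Hall; rewrite oG. Qed.

Lemma card_Sylow60_2 P : 2.-Sylow(G) P -> #|P| = 4.
Proof. by move/card_Sylow60->; rewrite p_part. Qed.

Lemma card_Sylow60_3 P : 3.-Sylow(G) P -> #|P| = 3.
Proof. by move/card_Sylow60->; rewrite p_part. Qed.

Lemma card_Sylow60_5 P : 5.-Sylow(G) P -> #|P| = 5.
Proof. by move/card_Sylow60->; rewrite p_part. Qed.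

Lemma card_norm_Sylow60 p P n : p.-Sylow(G) P -> #|'Syl_p(G)| = n ->
  (#|'N_G(P)| * n = 60)%N.
Proof. by move=> sylP <-; rewrite (card_Syl sylP) Lagrange ?subsetIl. Qed.

Lemma card_norm_Sylow60_3 P : 3.-Sylow(G) P -> #|'N_G(P)| = 6.
Proof. by move/card_norm_Sylow60/(_ card_Syl60_3); lia. Qed.

Lemma card_norm_Sylow60_5 P : 5.-Sylow(G) P -> #|'N_G(P)| = 10.
Proof. by move/card_norm_Sylow60/(_ card_Syl60_5); lia. Qed.

(* Otherwise X and a Sylow 3-subgroup Q of M would commute, and M would have
   |M : N_M(Q)| = 2 Sylow 3-subgroups. *)
Lemma card12_no_normal2 M X : M \subset G -> #|M| = 12 -> X <| M -> #|X| <> 2.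
Proof.
move=> sMG oM /andP[sXM nXM] oX.
have [Q sylQ sylQG] : exists2 Q : {group gT}, 3.-Sylow(M) Q & 3.-Sylow(G) Q.
  have part3 : (12`_3)%N = 3 by rewrite p_part.
  by apply: Sylow_exists_sub sMG _; rewrite oM oG part3 p_part.
have oQ := card_Sylow60_3 sylQG; have sQM := pHall_sub sylQ.
have nXQ := subset_trans sQM nXM.
have tiXQ : X :&: Q = 1 by apply: coprime_TIg; rewrite oX oQ.
have oXQ : #|X <*> Q| = 6 by rewrite norm_joinEr // TI_cardMg // oX oQ.
have sXQM : X <*> Q \subset M by rewrite join_subG sXM.
have nQXQ : X <*> Q \subset 'N(Q).
  apply/normal_norm/index2_normal; first exact: joing_subr.
  by rewrite -divgS ?joing_subr // oXQ oQ.
have sXQN : X <*> Q \subset 'N_M(Q) by rewrite subsetI sXQM.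
have oN : #|'N_M(Q)| = 6.
  have := subset_leq_card sXQN; rewrite oXQ.
  have := subset_leq_card (setSI 'N(Q) sMG); rewrite card_norm_Sylow60_3 //.
  by move=> le6 ge6; apply/eqP; rewrite eqn_leq le6 ge6.
have := @card_Syl_mod 3 _ M isT; rewrite (card_Syl sylQ) -divgS ?subsetIl //.
by rewrite oM oN.
Qed.

(** The normalizer contains the abelian group [S], so its order is a multiple of 4 among the orders
    of proper subgroups: 4 or 12. A normal subgroup of order 2 rules out 12. *)
Lemma norm60_order2 S X :
  2.-Sylow(G) S -> X \subset S -> #|X| = 2 -> 'N_G(X) = S.
Proof.
move=> sylS sXS oX; have oS := card_Sylow60_2 sylS; have sSG := pHall_sub sylS.
have cSS : abelian S by apply: (@card_p2group_abelian _ 2).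
have sSN : S \subset 'N_G(X) by rewrite subsetI sSG sub_abelian_norm.
have prN : 'N_G(X) \proper G.
  have sXG := subset_trans sXS sSG.
  apply: norm_proper_simple => //; first by rewrite -cardG_gt1 oX.
  by apply/eqP=> defX; rewrite defX oG in oX.
have := cardSg sSN; rewrite oS.
have : #|'N_G(X)| != 12.
  apply/eqP=> oN; apply: (card12_no_normal2 (subsetIl G _) oN _ oX).
  by rewrite normal_subnorm (subset_trans sXS).
have := proper60_card prN; rewrite !inE => /or4P[|||/or4P[|||/orP[]]] /eqP oN;
  rewrite oN // => _ _; by apply/esym/eqP; rewrite eqEcard sSN oN oS.
Qed.

(** A common involution generates a subgroup whose normalizer equals both [S] and [T]. *)
Lemma Sylow2_TI S T : 2.-Sylow(G) S -> 2.-Sylow(G) T -> S != T -> S :&: T = 1.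
Proof.
move=> sylS sylT; apply: contraNeq => ntST.
have p2ST : 2.-group (S :&: T) := pgroupS (subsetIl S T) (pHall_pgroup sylS).
have [_ d2 _] := pgroup_pdiv p2ST ntST.
have [x /setIP[Sx Tx] ox] := Cauchy (isT : prime 2) d2.
have oX : #|<[x]>| = 2 by [].
apply/eqP/val_inj => /=.
rewrite -(norm60_order2 sylS _ oX) ?cycle_subG //.
by rewrite (norm60_order2 sylT _ oX) ?cycle_subG.
Qed.

(* Fifteen Sylow 2-subgroups would contribute 45 elements, besides the 24
   elements of order 5. *)
Lemma card_Syl60_2 : #|'Syl_2(G)| = 5.
Proof.
have : #|'Syl_2(G)| \in [:: 5; 15]%N.
  by apply: (@card_Syl60_divisor 2 (mem [:: 5; 15]%N)).
rewrite !inE => /orP[/eqP//|/eqP n2].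
have : #|'Syl_2(G)| * 4.-1 + #|'Syl_5(G)| * 5.-1 < #|G|.
  apply: ltn_card_TI_families => // [A|A|A|A|A B|A B]; rewrite ?inE.
  - exact: pHall_sub.
  - exact: pHall_sub.
  - exact: card_Sylow60_2.
  - exact: card_Sylow60_5.
  - exact: Sylow2_TI.
  move=> /card_Sylow60_5 oA /card_Sylow60_5 oB.
  by apply: TI_prime_card; rewrite oA.
by rewrite oG card_Syl60_5 n2.
Qed.

Lemma card_norm_Sylow60_2 P : 2.-Sylow(G) P -> #|'N_G(P)| = 12.
Proof. by move/card_norm_Sylow60/(_ card_Syl60_2); lia. Qed.

(** A minimal normal subgroup [K] of the solvable group [M] is a p-group with p = 2 or 3. For p = 3
    it would be Sylow in [G] with a normalizer of order 6, too small for [M]. For p = 2 the order 2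
    is excluded, so [K] has order 4. *)
Lemma card12_normal_Sylow2 M : M \subset G -> #|M| = 12 ->
  exists2 S : {group gT}, 2.-Sylow(G) S & S <| M.
Proof.
move=> sMG oM.
have solM : solvable M by apply: Burnside_p_a_q_b; rewrite oM.
have ntM : M :!=: 1 by rewrite -cardG_gt1 oM.
have [K minK sKM] := minnormal_exists ntM (normG M).
have [nKM ntK /is_abelemP[p p_pr /abelem_pgroup pK]] :=
  minnormal_solvable minK sKM solM.
have dvK : #|K| %| 12 by rewrite -oM cardSg.
have sKG := subset_trans sKM sMG.
have nsK : K <| M by apply/andP.
have [_ pdvK _] := pgroup_pdiv pK ntK.
have : p \in primes 12 by rewrite mem_primes p_pr (dvdn_trans pdvK).
rewrite !inE => /orP[] /eqP p_eq; subst p.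
  exists K => //; rewrite pHallE sKG /= oG p_part /=.
  have := card12_no_normal2 sMG oM nsK.
  have := card_pgroup pK; have := dvK; have := ntK; rewrite -cardG_gt1.
  case: (logn 2 #|K|) => [|[|[|n]]] lt1 dv12 oK; rewrite oK // in lt1 dv12 *.
  by move: dv12; rewrite (expnD 2 3 n) => /(dvdn_trans (dvdn_mulr _ (dvdnn _))).
have sylK : 3.-Sylow(G) K.
  rewrite pHallE sKG /= oG p_part /=.
  have := card_pgroup pK; have := dvK; have := ntK; rewrite -cardG_gt1.
  case: (logn 3 #|K|) => [|[|n]] lt1 dv12 oK; rewrite oK // in lt1 dv12 *.
  by move: dv12; rewrite (expnD 3 2 n) => /(dvdn_trans (dvdn_mulr _ (dvdnn _))).
have : #|M| <= #|'N_G(K)| by rewrite subset_leq_card // subsetI sMG.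
by rewrite oM (card_norm_Sylow60_3 sylK).
Qed.

(** [H] lies in the normalizer of [S], a conjugate of that of [P], and equals it by order. *)
Lemma normal_Sylow_class p P S H :
  p.-Sylow(G) P -> p.-Sylow(G) S -> H \subset G -> S <| H -> #|H| = #|'N_G(P)| ->
  H \in orbit 'JG G 'N_G(P)%G.
Proof.
move=> sylP sylS sHG nsSH oH; have [x Gx defS] := Sylow_trans sylP sylS.
apply: mem_class_conj (Gx) _; rewrite conjIg conjGid // -normJ -defS.
apply/eqP; rewrite eqEcard subsetI sHG normal_norm //= oH.
by rewrite defS normJ -{1}(conjGid Gx) -conjIg cardJg.
Qed.

(* The centralizer of an involution of S is S, so its class in N_G(S) has
   12 / 4 = 3 elements and exhausts S^#. *)
Lemma order2_subgroups_conj S X Y :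
    2.-Sylow(G) S -> X \subset S -> Y \subset S ->
  #|X| = 2 -> #|Y| = 2 -> Y \in orbit 'JG G X.
Proof.
move=> sylS sXS sYS oX oY.
have oS := card_Sylow60_2 sylS; have sSG := pHall_sub sylS.
have cSS : abelian S by apply: (@card_p2group_abelian _ 2).
have /cyclicP[x defX] : cyclic X by rewrite prime_cyclic ?oX.
have /cyclicP[y defY] : cyclic Y by rewrite prime_cyclic ?oY.
have Sx : x \in S by rewrite -cycle_subG -defX.
have Sy : y \in S by rewrite -cycle_subG -defY.
have neq1 (z : gT) (Z : {group gT}) : Z :=: <[z]> -> #|Z| = 2 -> z != 1.
  by move=> defZ oZ; rewrite -cycle_eq1 -defZ -cardG_gt1 oZ.
have defC : 'C_G[x] = S.
  apply/eqP; rewrite eqEsubset -{1}(norm60_order2 sylS sXS oX) defX.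
  rewrite setIS ?cent1_sub ?cycle_subG //=.
    by rewrite subsetI sSG sub_cent1 (subsetP cSS).
  by rewrite -cent_cycle cent_sub.
have sSN : S \subset 'N_G(S) by rewrite subsetI sSG normG.
have defxN : x ^: 'N_G(S) = S^#.
  apply/eqP; rewrite eqEcard; apply/andP; split.
    apply/subsetP=> _ /imsetP[z /setIP[_ nSz] ->].
    by rewrite !inE conjg_eq1 (neq1 _ _ defX oX) memJ_norm.
  rewrite -index_cent1 (_ : 'C_('N_G(S))[x] = S).
    rewrite -divgS // card_norm_Sylow60_2 // oS.
    by have := oS; rewrite (cardsD1 1 S) group1 add1n => -[->].
  by rewrite setIAC defC; apply/setIidPl/normG.
have : y \in S^# by rewrite !inE (neq1 _ _ defY oY).
rewrite -defxN => /imsetP[z /setIP[Gz _] defy].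
by apply: mem_class_conj Gz _; rewrite defY defX defy cycleJ.
Qed.

End Order60.

Section Classes60.

Variables (gT : finGroupType) (G : {group gT}).
Hypotheses (simpleG : simple G) (oG : #|G| = 60).
Implicit Types (A H P S X : {group gT}).

Lemma simple60_counts : kprime G = 9 /\ #|subgroups G| = 59.
Proof.
have [V sylV] := Sylow_exists 2 G; have [Q sylQ] := Sylow_exists 3 G.
have [P sylP] := Sylow_exists 5 G.
have oV := card_Sylow60_2 oG sylV; have oQ := card_Sylow60_3 oG sylQ.
have oP := card_Sylow60_5 oG sylP.
have oNV := card_norm_Sylow60_2 simpleG oG sylV.
have oNQ := card_norm_Sylow60_3 simpleG oG sylQ.
have oNP := card_norm_Sylow60_5 simpleG oG sylP.
have [x Vx ox] : {x | x \in V & #[x] = 2} by apply: Cauchy; rewrite ?oV.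
pose X := <[x]>%G; have oX : #|X| = 2 by [].
have sXV : X \subset V by rewrite cycle_subG.
(* The orders are 1, 2, 3, 4, 5, 6, 10, 12, 60; the order of a subgroup turns out to determine its
   class. *)
pose t := [:: 1%G; X; Q; V; P; 'N_G(Q)%G; 'N_G(P)%G; 'N_G(V)%G; G].
have [||H sHG|k9 L59] := @subgroup_classes_transversal _ G t.
- apply/allP; rewrite /= sub1G (subset_trans sXV) ?(pHall_sub sylV) //.
  by rewrite (pHall_sub sylQ) (pHall_sub sylP) !subsetIl subxx.
- by rewrite /= cards1 oX oQ oV oP oNQ oNP oNV oG.
- have [defH|prH] := eqVproper sHG.
    exists G; first by rewrite !inE eqxx !orbT.
    by rewrite (group_inj defH) orbit_refl.
  have syl_class p S A : p.-Sylow(G) S -> p.-Sylow(G) A -> A \in orbit 'JG G S.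
    move=> sylS sylA; have [y Gy defA] := Sylow_trans sylS sylA.
    exact: mem_class_conj Gy defA.
  have sylH (p : nat) : #|H| = (#|G|`_p)%N -> p.-Sylow(G) H.
    by rewrite pHallE sHG /= => ->.
  (* Orders 6 and 10: a Sylow p-subgroup of [H] has index 2, hence is normal in [H]. *)
  have norm_class (p : nat) S : odd p -> p.-Sylow(G) S ->
      #|H| = #|'N_G(S)| -> #|H| = (2 * #|G|`_p)%N ->
    H \in orbit 'JG G 'N_G(S)%G.
    move=> odd_p sylS oH oH2.
    have [T sylT sylTG] : exists2 T : {group gT}, p.-Sylow(H) T & p.-Sylow(G) T.
      apply: Sylow_exists_sub sHG _; rewrite oH2 partnM //.
      rewrite (part_pnat_id (part_pnat _ _)) part_p'nat ?mul1n //.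
      by rewrite pnatE // !inE; case: eqP odd_p => // <-.
    apply: (normal_Sylow_class sylS sylTG sHG _ oH).
    apply: index2_normal (pHall_sub sylT) _.
    rewrite -divgS ?(pHall_sub sylT) // (card_Hall sylTG) oH2 mulnK //.
  have := proper60_card simpleG oG prH.
  rewrite !inE => /or4P[|||/or4P[|||/orP[]]] /eqP oH.
  + exists 1%G; first by rewrite !inE eqxx.
    rewrite (_ : H = 1%G) ?orbit_refl //.
    by apply/val_inj/card_le1_trivg; rewrite oH.
  + exists X; first by rewrite !inE eqxx !orbT.
    have pH : 2.-group H by rewrite /pgroup oH.
    have [y Gy sHyV] := Sylow_Jsub sylV sHG pH.
    rewrite -(orbit_actr _ _ _ Gy).
    by apply: (order2_subgroups_conj simpleG oG sylV) => //=; rewrite cardJg.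
  + exists Q; first by rewrite !inE eqxx !orbT.
    by apply: (syl_class _ _ _ sylQ (sylH _ _)); rewrite oH -(card_Hall sylQ).
  + exists V; first by rewrite !inE eqxx !orbT.
    by apply: (syl_class _ _ _ sylV (sylH _ _)); rewrite oH -(card_Hall sylV).
  + exists P; first by rewrite !inE eqxx !orbT.
    by apply: (syl_class _ _ _ sylP (sylH _ _)); rewrite oH -(card_Hall sylP).
  + exists 'N_G(Q)%G; first by rewrite !inE eqxx !orbT.
    apply: (norm_class 3 Q isT sylQ _ _); rewrite ?oNQ //.
    by rewrite -(card_Hall sylQ) oQ.
  + exists 'N_G(P)%G; first by rewrite !inE eqxx !orbT.
    apply: (norm_class 5 P isT sylP _ _); rewrite ?oNP //.
    by rewrite -(card_Hall sylP) oP.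
  exists 'N_G(V)%G; first by rewrite !inE eqxx !orbT.
  have [S sylS nsSH] := card12_normal_Sylow2 simpleG oG sHG oH.
  by apply: (normal_Sylow_class sylV sylS sHG nsSH _); rewrite oNV.
split; rewrite // L59 !big_cons big_nil.
(* Class sizes: [X] has normalizer [V], and the three Sylow normalizers are self-normalizing. *)
rewrite (norm60_order2 simpleG oG sylV sXV oX) /=.
rewrite !(norm_norm_Sylow sylV, norm_norm_Sylow sylQ, norm_norm_Sylow sylP).
have -> : 'N_G(1) = G by rewrite norm1 setIT.
have -> : 'N_G(G) = G by apply/setIidPl/normG.
rewrite indexgg -!divgS ?subsetIl ?(pHall_sub sylV) //.
by rewrite oNV oNQ oNP oV oG.
Qed.

Lemma dprime_simple60 : dprime G = (9%:R / 59%:R)%R.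
Proof. by rewrite /dprime; have [-> ->] := simple60_counts. Qed.

End Classes60.

(** * The degree of the sections of Alt_5 *)

Section Ratios.

Variables (gT : finGroupType) (G : {group gT}).

Lemma card_subgroups_gt0 : 0 < #|subgroups G|.
Proof. by apply/card_gt0P; exists G; rewrite inE. Qed.

Lemma dprime_ge_ratio a b : 0 < b ->
  (a%:R / b%:R <= dprime G)%R = (a * #|subgroups G| <= b * kprime G).
Proof.
move=> b_gt0; rewrite /dprime ler_pdivrMr ?ltr0n // mulrAC.
by rewrite ler_pdivlMr ?ltr0n ?card_subgroups_gt0 // -!natrM ler_nat (mulnC b).
Qed.

Lemma dprime_le_ratio a b : 0 < b ->
  (dprime G <= a%:R / b%:R)%R = (b * kprime G <= a * #|subgroups G|).
Proof.
move=> b_gt0; rewrite /dprime ler_pdivlMr ?ltr0n // mulrAC.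
by rewrite ler_pdivrMr ?ltr0n ?card_subgroups_gt0 // -!natrM ler_nat (mulnC b).
Qed.

End Ratios.

(** * Lower bounds on the degree of groups of small order *)

Section SmallGroups.

Variables (gT : finGroupType) (G : {group gT}).
Implicit Types (H K P Q S X : {group gT}).

Lemma kprime_abelian : abelian G -> kprime G = #|subgroups G|.
Proof.
move=> cGG; apply: card_in_imset => A B; rewrite !inE => sAG sBG eqAB.
have /orbitP[x Gx <-] : A \in orbit 'JG G B by rewrite -eqAB orbit_refl.
apply: val_inj => /=; apply/normP/(subsetP _ _ Gx)/sub_abelian_norm => //.
Qed.

Lemma card_cyclic_subgroups_le (L : {set {group gT}}) :
    {in L, forall H, H \subset G /\ cyclic H} -> #|L| <= #|G|.
Proof.
move=> cycL; apply: leq_trans (leq_imset_card (fun x => <[x]>%G) (mem G)).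
apply/subset_leq_card/subsetP=> H /cycL[sHG /cyclicP[x defH]].
apply/imsetP; exists x; last exact: val_inj.
by rewrite -cycle_subG -defH.
Qed.

Lemma kprime_gt1 : G :!=: 1 -> 1 < kprime G.
Proof.
move=> ntG; apply: (@size_le_kprime _ G [:: 1%G; G]).
  by apply/allP; rewrite /= sub1G subxx.
by rewrite /= cards1 inE eq_sym -trivg_card1 ntG.
Qed.

(** All proper subgroups are cyclic, so there are at most |G| of them; the extra one is [G]. *)
Lemma card_subgroups_pq p q : prime p -> prime q -> #|G| = (p * q)%N ->
  #|subgroups G| <= #|G|.+1.
Proof.
move=> p_pr q_pr oG; rewrite (cardsD1 G) inE subxx add1n ltnS.
apply: card_cyclic_subgroups_le => H /setD1P[neqHG]; rewrite inE => sHG.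
split=> //; have dvH := cardSg sHG; rewrite oG in dvH.
have prH : #|H| < #|G|.
  rewrite ltn_neqAle subset_leq_card // andbT; apply: contra neqHG => /eqP oH.
  by rewrite -val_eqE eqEcard sHG oH /=.
have [pH|p'H] := boolP (p %| #|H|).
  have /dvdnP[m oH] := pH; rewrite oH mulnC dvdn_pmul2l ?prime_gt0 // in dvH.
  have /primeP[_ /(_ m dvH)/orP[]/eqP def_m] := q_pr.
    by rewrite prime_cyclic // oH def_m mul1n.
  by move: prH; rewrite oH def_m oG mulnC ltnn.
rewrite Gauss_dvdr in dvH; last by rewrite coprime_sym prime_coprime.
have /primeP[_ /(_ _ dvH)/orP[]/eqP oH] := q_pr; last first.
  by rewrite prime_cyclic ?oH.
by rewrite (card_le1_trivg (eq_leq oH)) cyclic1.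
Qed.

Lemma card_subgroups12 : #|G| = 12 -> #|subgroups G| <= 28.
Proof.
move=> oG; have [Q sylQ] := Sylow_exists 3 G.
have oQ : #|Q| = 3 by rewrite (card_Hall sylQ) oG p_part.
pose C := [set H in subgroups G | cyclic H].
pose D := (fun x => (Q <*> <[x]>)%G) @: G.
(* The subgroups of order 6 contain the normal closure of Q, hence are
   generated by Q and an involution. *)
have sub : subgroups G \subset C :|: 'Syl_2(G) :|: D :|: [set G].
  apply/subsetP=> H; rewrite !inE => sHG; rewrite sHG /=.
  have dvH : #|H| %| 12 by rewrite -oG cardSg.
  have : #|H| \in [:: 1; 2; 3; 4; 6; 12]%N.
    exact: (all_divisorsP (a := mem [:: 1; 2; 3; 4; 6; 12]%N) dvH).
  rewrite !inE => /or4P[|||/or3P[]] /eqP oH.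
  - by rewrite (card_le1_trivg (eq_leq oH)) cyclic1.
  - by rewrite prime_cyclic ?oH.
  - by rewrite prime_cyclic ?oH.
  - by rewrite pHallE sHG oG p_part oH orbT.
  - rewrite (_ : H \in D) ?orbT //.
    have sQH : Q \subset H.
      have nsHG : H <| G by apply: index2_normal; rewrite -?divgS // oG oH.
      have [R sylR] := Sylow_exists 3 H; have sRH := pHall_sub sylR.
      have sylRG : 3.-Sylow(G) R.
        by rewrite pHallE (subset_trans sRH) //= (card_Hall sylR) oH oG !p_part.
      have [x Gx ->] := Sylow_trans sylRG sylQ.
      by rewrite -(normsP (normal_norm nsHG) x Gx) conjSg.
    have [x Hx ox] : {x | x \in H & #[x] = 2} by apply: Cauchy; rewrite ?oH.
    apply/imsetP; exists x; first exact: (subsetP sHG).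
    apply: val_inj => /=; apply/eqP; rewrite eq_sym eqEcard.
    rewrite join_subG sQH cycle_subG Hx /= oH.
    apply: dvdn_leq; first exact: cardG_gt0.
    rewrite (@Gauss_dvd 2 3) // -{1}ox -oQ.
    by rewrite !cardSg ?joing_subl ?joing_subr.
  by rewrite -val_eqE eqEcard sHG oG oH /= orbT.
(* The bound is 12 cyclic subgroups, 3 Sylow 2-subgroups, 12 members of [D], and [G]: 28 in all. *)
apply: leq_trans (subset_leq_card sub) _.
apply: leq_trans (leq_card_setU _ _) _; rewrite cards1.
apply: leq_trans (leq_add (leq_card_setU _ _) (leqnn _)) _.
have leC : #|C :|: 'Syl_2(G)| <= 12 + 3.
  apply: leq_trans (leq_card_setU _ _) (leq_add _ _).
    rewrite -oG; apply: card_cyclic_subgroups_le => H.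
    by rewrite !inE => /andP[].
  have : #|'Syl_2(G)| %| 12 by rewrite -oG card_Syl_dvd.
  have := @card_Syl_mod 2 _ G isT => /eqP mod2 dv.
  have := all_divisorsP (a := fun m => (m %% 2 == 1%N) ==> (m <= 3)) dv isT isT.
  by rewrite mod2.
have leD : #|D| <= 12 by rewrite -oG leq_imset_card.
by have := leq_add (leq_add leC leD) (leqnn 1).
Qed.

Lemma kprime12 : #|G| = 12 -> 4 < kprime G.
Proof.
move=> oG; have [V sylV] := Sylow_exists 2 G; have [Q sylQ] := Sylow_exists 3 G.
have oV : #|V| = 4 by rewrite (card_Hall sylV) oG p_part.
have oQ : #|Q| = 3 by rewrite (card_Hall sylQ) oG p_part.
have [x Gx ox] : {x | x \in G & #[x] = 2} by apply: Cauchy; rewrite ?oG.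
have oX : #|<[x]>%G| = 2 by [].
apply: (@size_le_kprime _ G [:: 1%G; <[x]>%G; Q; V; G]).
  apply/allP; rewrite /= sub1G subxx cycle_subG Gx.
  by rewrite (pHall_sub sylV) (pHall_sub sylQ).
by rewrite /= cards1 oX oV oQ oG.
Qed.

(** These are the possible orders of proper subgroups of a simple group of order 60. Abelian groups
    have degree 1; for orders 6 and 10, at least 2 classes and at most 13 subgroups suffice, as 9 *
    13 <= 59 * 2; for order 12, 9 * 28 <= 59 * 5. *)
Lemma dprime_ge_small_order : #|G| \in [:: 1; 2; 3; 4; 5; 6; 10; 12]%N ->
  (9%:R / 59%:R <= dprime G)%R.
Proof.
rewrite dprime_ge_ratio //.
have abelG : abelian G -> 9 * #|subgroups G| <= 59 * kprime G.
  by move/kprime_abelian->; rewrite leq_mul2r orbT.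
have pqG p q : prime p -> prime q -> #|G| = (p * q)%N -> #|G| <= 12 ->
    9 * #|subgroups G| <= 59 * kprime G.
  move=> p_pr q_pr oG le12.
  have ntG : G :!=: 1.
    rewrite -cardG_gt1 oG.
    by have := prime_gt1 p_pr; have := prime_gt0 q_pr; nia.
  have := kprime_gt1 ntG; have := card_subgroups_pq p_pr q_pr oG; lia.
have primeG : prime #|G| -> abelian G by move/prime_cyclic/cyclic_abelian.
rewrite !inE => /or4P[|||/or4P[|||/orP[]]] /eqP oG.
- by apply: abelG; rewrite (card_le1_trivg (eq_leq oG)) abelian1.
- by apply/abelG/primeG; rewrite oG.
- by apply/abelG/primeG; rewrite oG.
- by apply: abelG; apply: (@card_p2group_abelian _ 2).
- by apply/abelG/primeG; rewrite oG.
- by apply: (pqG 2 3); rewrite ?oG.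
- by apply: (pqG 2 5); rewrite ?oG.
by have := card_subgroups12 oG; have := kprime12 oG; clear; lia.
Qed.

End SmallGroups.

Lemma dstar_simple60 (gT : finGroupType) (G : {group gT}) :
  simple G -> #|G| = 60 -> dstar G = (9%:R / 59%:R)%R.
Proof.
move=> simG oG; have isoG := quotient1_isog G.
(* The section [G / 1] is only isomorphic to [G]; being simple of order 60 itself, it gets its
   degree from the same count. *)
have d1 : dprime (G / 1)%G = (9%:R / 59%:R)%R.
  by apply: dprime_simple60; rewrite /= -?(isog_simple isoG) -?(card_isog isoG).
have le1 : (dstar G <= dprime (G / 1)%G)%R := dstar_min (subxx G) (normal1 G).
rewrite d1 in le1; apply/eqP; rewrite eq_le le1 /= {le1}.
have [H [N [sHG nsNH ->]]] := dstar_attained G.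
have [prH|] := boolP (H \proper G).
  have oq : #|(H / N)%G| = #|H : N| by rewrite card_quotient ?normal_norm.
  pose l := [:: 1; 2; 3; 4; 5; 6; 10; 12]%N.
  (* The list is closed under divisors, so it also contains the orders of the sections of proper
     subgroups. *)
  have closed_l : all (fun k => all (mem l) (divisors k)) l by [].
  suff: #|(H / N)%G| \in l by move/dprime_ge_small_order.
  have := allP closed_l _ (proper60_card simG oG prH); rewrite oq.
  exact: all_divisorsP (dvdn_indexg H N) (cardG_gt0 H).
rewrite properE sHG negbK => sGH.
have defH : H = G by apply/val_inj/eqP; rewrite eqEsubset sHG.
rewrite {}defH in nsNH *; have /simpleP[_ /(_ N nsNH)[defN|defN]] := simG.
  have -> : N = 1%G by apply: val_inj.
  by rewrite d1; exact: lexx.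
have oq : #|(G / N)%G| = 1%N by rewrite /= defN trivg_quotient cards1.
have : #|(G / N)%G| \in [:: 1; 2; 3; 4; 5; 6; 10; 12]%N by rewrite oq.
by move/dprime_ge_small_order.
Qed.

Lemma simple_Alt_I5 : simple 'Alt_('I_5) /\ #|'Alt_('I_5)| = 60.
Proof.
split; first by apply: simple_Alt5; rewrite card_ord.
by apply: double_inj; rewrite -mul2n card_Alt card_ord.
Qed.

(** * Minimal simple groups *)

Section Simple.

Variables (gT : finGroupType) (G : {group gT}).
Hypotheses (simpleG : simple G) (nsolG : ~~ solvable G).
Implicit Types (A H P Q : {group gT}).

Lemma card_Syl_constraints p : prime p -> p %| #|G| ->
  [/\ 4 < #|'Syl_p(G)|, #|'Syl_p(G)| %% p = 1%N & #|'Syl_p(G)| %| #|G|].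
Proof.
move=> p_pr pG; have [P sylP [-> prN]] := card_Syl_proper simpleG nsolG p_pr pG.
rewrite -(card_Syl sylP) card_Syl_mod // card_Syl_dvd (card_Syl sylP).
by rewrite proper_index_ge5.
Qed.

(** Ten Sylow 3-subgroups and six Sylow 5-subgroups would contribute 20 + 24 nontrivial elements. *)
Lemma simple_not30 : #|G| != 30.
Proof.
apply/eqP=> oG.
have [||n5 mod5 dv5] := @card_Syl_constraints 5; rewrite ?oG //.
have [||n3 mod3 dv3] := @card_Syl_constraints 3; rewrite ?oG //.
rewrite oG in dv3 dv5.
have := all_divisorsP
  (a := fun n => (4 < n) && (n %% 3 == 1%N) ==> (n == 10)) dv3 isT isT.
have := all_divisorsP
  (a := fun n => (4 < n) && (n %% 5 == 1%N) ==> (n == 6)) dv5 isT isT.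
rewrite n5 n3 mod5 mod3 /= => /eqP s5 /eqP s3.
have p3 : (30`_3)%N = 3 by rewrite p_part.
have p5 : (30`_5)%N = 5 by rewrite p_part.
have oS3 A : 3.-Sylow(G) A -> #|A| = 3 by move/card_Hall->; rewrite oG.
have oS5 A : 5.-Sylow(G) A -> #|A| = 5 by move/card_Hall->; rewrite oG.
have : #|'Syl_3(G)| * 3.-1 + #|'Syl_5(G)| * 5.-1 < #|G|.
  apply: ltn_card_TI_families => // [A|A|A|A|A B|A B]; rewrite ?inE;
    try by [apply: pHall_sub | apply: oS3 | apply: oS5].
  - by move=> /oS3 oA /oS3 oB; apply: TI_prime_card; rewrite oA.
  by move=> /oS5 oA /oS5 oB; apply: TI_prime_card; rewrite oA.
by rewrite oG s3 s5.
Qed.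

(* Otherwise N_G(P) contains some Sylow q-subgroup Q, and G = N_G(Q) N_G(P) by
   coprimality, so N_G(P) contains all conjugates of Q. *)
Lemma prime_dvd_card_Syl_coprime p q :
    prime p -> prime q -> p %| #|G| -> q %| #|G| ->
    coprime #|'Syl_p(G)| #|'Syl_q(G)| -> q %| #|'Syl_p(G)|.
Proof.
move=> p_pr q_pr pG qG co_pq; apply/negP=> /negP q'n.
have [P sylP [nP prN]] := card_Syl_proper simpleG nsolG p_pr pG.
have [Q sylQ sylQG] :
    exists2 Q : {group gT}, q.-Sylow('N_G(P)) Q & q.-Sylow(G) Q.
  apply: Sylow_exists_sub (subsetIl _ _) _.
  rewrite -(Lagrange (subsetIl G 'N(P))) partnM // ?cardG_gt0 //.
  by rewrite -nP [X in (_ * X)%N]part_p'nat ?muln1 // p'natE.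
have defG : 'N_G(Q) * 'N_G(P) = G.
  apply: coprime_index_mulG; rewrite ?subsetIl //.
  by rewrite -nP -(card_Syl sylQG) coprime_sym.
have sQcore : Q \subset gcore 'N_G(P) G.
  apply/bigcapsP=> x Gx; rewrite -sub_conjgV.
  have : x^-1 \in 'N_G(Q) * 'N_G(P) by rewrite defG groupV.
  case/mulsgP=> a b /setIP[_ nQa] Nb ->; rewrite conjsgM (normP nQa).
  by rewrite sub_conjg conjGid ?groupV // (pHall_sub sylQ).
have [_ ntQ _] := Sylow_nontriv_proper nsolG q_pr qG sylQG.
have /simpleP[_ /(_ (gcore_group 'N_G(P) G))] := simpleG.
case=> [|core1|coreG]; first by apply: gcore_normal; apply: subsetIl.
  by case/eqP: ntQ; apply/trivgP; rewrite -core1.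
by case/andP: prN => _ /negP[]; rewrite -{1}coreG gcore_sub.
Qed.

End Simple.

Section MinimalSimple.

Variables (gT : finGroupType) (G : {group gT}).
Hypotheses (simpleG : simple G) (nsolG : ~~ solvable G).
Hypothesis sol_proper : forall H : {group gT}, H \proper G -> solvable H.
Implicit Types (A H P Q : {group gT}).

(** The coset action embeds [G] in an alternating group of degree 5 or 6. Proper subgroups of the
    former have orders with at most two prime divisors, so [G] fills it; in the latter [G] is proper
    and its index bounds its order. *)
Lemma card60_of_small_index H : H \proper G -> #|G : H| <= 6 -> #|G| = 60.
Proof.
move=> prH le6; have ge5 := proper_index_ge5 simpleG nsolG prH.
have [T [f injf oT]] := simple_injm_perm simpleG prH.
set K := (f @* G)%G; have oK : #|K| = #|G| by rewrite card_injm.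
have simK : simple K by rewrite -(isog_simple (sub_isog (subxx G) injf)).
have three := nsol_three_primes nsolG (dvdnn _) (cardG_gt0 G).
have sKA : K \subset 'Alt_T.
  apply: simple_subset_Alt; rewrite // oK ltnNge; apply/negP=> le2.
  by move: three; have := cardG_gt0 G; move: #|G| le2 => [|[|[]]].
have ge5T : 4 < #|T| by rewrite oT.
have simA := simple_Alt5 ge5T.
have nsolA : ~~ solvable 'Alt_T by rewrite solvable_AltF.
have oA : (2 * #|'Alt_T|)%N = #|T|`! by rewrite card_Alt // (leq_trans _ ge5T).
have [T5|T6] : #|T| = 5 \/ #|T| = 6.
- by move: #|G : H| ge5 le6 oT => [|[|[|[|[|[|[|]]]]]]] // _ _ ->; [left|right].
- have {}oA : #|'Alt_T| = 60 by apply: double_inj; rewrite -mul2n oA T5.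
  have [defK|prK] := eqVproper sKA; first by rewrite -oK defK.
  have := proper60_card simA oA prK; rewrite oK => Gl.
  have /allP/(_ _ Gl) :
    all (fun k => size (primes k) <= 2) [:: 1; 2; 3; 4; 5; 6; 10; 12]%N by [].
  by rewrite leqNgt three.
have {}oA : #|'Alt_T| = 360 by apply: double_inj; rewrite -mul2n oA T6.
have [defK|prK] := eqVproper sKA.
  have [x _] : {x : T | x \in [set: T]}.
    by apply/sigW/card_gt0P; rewrite cardsT T6.
  (* Alt_6 is not minimal: its point stabilizers are Alt_5. *)
  pose C := 'C_(K)[x | 'P]%G.
  have isoC : C \isog 'Alt_{y : T | y != x} by rewrite /C /= defK rfd_iso.
  have oT' : #|{: {y : T | y != x}}| = 5.
    by rewrite card_sub (eq_card (B := predC1 x)) // cardC1 T6.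
  have oC : #|C| = 60.
    by rewrite (card_isog isoC); apply: double_inj; rewrite -mul2n card_Alt oT'.
  have : solvable C.
    have sCK : C \subset f @* G by apply: subsetIl.
    rewrite -(morphpreK sCK) morphim_sol // sol_proper //.
    rewrite properEcard subsetIl /=.
    by rewrite -(card_injm injf) ?subsetIl // morphpreK // oC -oK defK oA.
  by rewrite (isog_sol isoC) solvable_AltF // oT'.
have ge5A := proper_index_ge5 simA nsolA prK.
have dvA := simple_dvd_index_fact simA prK; have LA := Lagrange sKA.
rewrite oA oK in dvA LA.
have le60 : #|G| <= 60.
  (* Index 5 is impossible because 360 does not divide 5!. *)
  have ge6 : 5 < #|'Alt_T : K|.
    rewrite ltn_neqAle ge5A andbT; apply/eqP=> idx5.
    by rewrite -idx5 in dvA.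
  rewrite -(leq_pmul2r (isT : 0 < 6)); apply: (leq_trans _ (eq_leq LA)).
  by rewrite leq_mul2l ge6 orbT.
have dvG : #|G| %| 360 by rewrite -LA dvdn_mulr.
(* Only 30 and 60 are divisors of 360 up to 60 with three prime factors. *)
have := all_divisorsP (a := fun k => (k <= 60) && (2 < size (primes k)) ==>
  ((k == 30) || (k == 60))) dvG isT isT.
rewrite le60 three (negbTE (simple_not30 simpleG nsolG)) /= => /eqP//.
Qed.

(** * Minimal simple groups whose proper subgroups all have index at least 7 *)

Section LargeIndex.

Hypothesis index_gt6 : forall H : {group gT}, H \proper G -> 6 < #|G : H|.

(** The weight bound applied to one Sylow subgroup for each prime in [s]; nontrivial Sylow subgroups
    for distinct primes have distinct orders. *)
Lemma kprime_le_Sylow_weight (s : seq nat) :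
    uniq s -> {subset s <= primes #|G|} ->
    59 * (size s).+2 <= 9 * (2 + \sum_(p <- s) #|'Syl_p(G)|) ->
  59 * kprime G <= 9 * #|subgroups G|.
Proof.
move=> Us sub_s le_s; pose S (p : nat) : {group gT} := sval (Sylow_exists p G).
have sylS p : p.-Sylow(G) (S p) := svalP (Sylow_exists p G).
have ntG : G :!=: 1 by case/simpleP: simpleG.
have propS p : p \in s -> [/\ S p \subset G, S p :!=: 1 & S p :!=: G].
  move=> /sub_s; rewrite mem_primes => /and3P[p_pr _ pG].
  exact: Sylow_nontriv_proper pG (sylS p).
apply: (@kprime_le_weight _ G [seq S p | p <- s]) => //.
- by move=> A sAG ntA neqAG; apply/index_gt6/norm_proper_simple.
- by move=> _ /mapP[p /propS[sSG _ _] ->].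
- rewrite -map_comp /= inE negb_or eq_sym -trivg_card1 ntG /=.
  apply/and3P; split.
  + apply/mapP=> [[p /propS[_ ntS _] /= o1]].
    by rewrite trivg_card1 -o1 in ntS.
  + apply/mapP=> [[p /propS[sSG _ neqSG] /= oS]].
    by case/eqP: neqSG; apply/eqP; rewrite eqEcard sSG oS /=.
  rewrite map_inj_in_uniq // => p q s_p s_q /= eq_pq.
  have := sub_s p s_p; have := sub_s q s_q.
  rewrite !mem_primes => /and3P[q_pr _ qG] /and3P[p_pr _ pG].
  have : p %| #|S q|.
    have [_ ntS _] := propS p s_p; rewrite -eq_pq.
    by have [] := pgroup_pdiv (pHall_pgroup (sylS p)) ntS.
  by move/(pgroupP (pHall_pgroup (sylS q)) p p_pr); rewrite inE => /eqP.
rewrite size_map big_map; congr (_ <= 9 * (2 + _)): le_s.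
by apply: eq_bigr => p _; apply: card_Syl.
Qed.

Lemma kprime_le_large_index : 59 * kprime G <= 9 * #|subgroups G|.
Proof.
pose n p := #|'Syl_p(G)|; pose piG p := prime p && (p %| #|G|).
have nP p : piG p -> [/\ 6 < n p, n p %% p = 1%N & forall q, piG q -> q <= n p].
  move=> /andP[p_pr pG].
  have [_ mod_n _] := card_Syl_constraints simpleG nsolG p_pr pG.
  have [P sylP [def_n prN]] := card_Syl_proper simpleG nsolG p_pr pG.
  rewrite /n; split=> // [|q /andP[q_pr qG]]; rewrite def_n ?index_gt6 //.
  exact: prime_le_index.
have third q r : exists p, [/\ piG p, p != q & p != r].
  have [p [p_pr pG npq npr]] := nsol_third_prime nsolG q r.
  by exists p; split=> //; apply/andP.
have W s : uniq s -> all piG s ->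
    59 * (size s).+2 <= 9 * (2 + \sum_(p <- s) n p) ->
    59 * kprime G <= 9 * #|subgroups G|.
  move=> Us /allP s_piG; apply: kprime_le_Sylow_weight => // p.
  by move=> /s_piG /andP[p_pr pG]; rewrite mem_primes p_pr cardG_gt0.
(* One, two or three Sylow classes of total size at least 18, 25, 31
   compensate the classes of 1 and G. *)
have W1 p : piG p -> 18 <= n p -> 59 * kprime G <= 9 * #|subgroups G|.
  move=> pP le_n; apply: (W [:: p]); rewrite /= ?pP // big_seq1.
  by move: (n p) le_n => m; clear; lia.
have W2 p q : piG p -> piG q -> p != q -> 25 <= n p + n q ->
    59 * kprime G <= 9 * #|subgroups G|.
  move=> pP qP npq le_n; apply: (W [:: p; q]); rewrite /= ?inE ?pP ?qP ?npq //.
  rewrite !big_cons big_nil; move: (n p) (n q) le_n => m1 m2; clear; lia.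
have W3 p q r : piG p -> piG q -> piG r -> [&& p != q, p != r & q != r] ->
    31 <= n p + n q + n r -> 59 * kprime G <= 9 * #|subgroups G|.
  move=> pP qP rP /and3P[npq npr nqr] le_n.
  apply: (W [:: p; q; r]);
    rewrite /= ?inE ?pP ?qP ?rP ?negb_or ?npq ?npr ?nqr //.
  rewrite !big_cons big_nil; move: (n p) (n q) (n r) le_n => m1 m2 m3.
  clear; lia.
(* Every prime divisor of |G| is at most every Sylow number, so a prime from 11 on makes any three
   Sylow numbers sum to at least 33. *)
have [/hasP[p]|/hasPn small] := boolP (has (leq 11) (primes #|G|)).
  rewrite mem_primes => /and3P[p_pr _ pG] ge11.
  have pP : piG p by apply/andP.
  have [q [qP nqp _]] := third p p; have [r [rP nrp nrq]] := third p q.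
  have le_n s : piG s -> 11 <= n s.
    by case/nP=> _ _ /(_ p pP); apply: leq_trans.
  apply: (W3 p q r) => //; first by rewrite !(eq_sym _ q) !(eq_sym _ r) nqp nrp.
  have le33 := leq_add (leq_add (le_n _ pP) (le_n _ qP)) (le_n _ rP).
  exact: leq_trans le33.
have {}small p : piG p -> p \in [:: 2; 3; 5; 7]%N.
  move=> pP; have := pP => /andP[p_pr pG]; have := small p.
  rewrite mem_primes p_pr cardG_gt0 pG -ltnNge => /(_ isT).
  by move: p p_pr {pP pG}; do 11 case=> //.
have n_piG p q : piG p -> prime q -> q %| n p -> piG q.
  move=> /andP[p_pr pG] q_pr dv; rewrite /piG q_pr /=.
  have [_ _ n_dv] := card_Syl_constraints simpleG nsolG p_pr pG.
  exact: dvdn_trans n_dv.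
have n_small p q : piG p -> prime q -> q %| n p -> q \in [:: 2; 3; 5; 7]%N.
  by move=> pP q_pr dv; apply/small/(n_piG p).
(* Prime divisors of a Sylow number divide |G|, so [n 5] = 11 would bring in the excluded prime
   11. *)
have n5 : piG 5 -> 16 <= n 5.
  move=> p5; have [gt6 mod5 _] := nP 5 p5.
  have : (n 5 == 11) || (16 <= n 5) by move: (n 5) gt6 mod5; clear; lia.
  case/orP=> // /eqP n11.
  by have := n_small 5 11 p5 isT; rewrite n11 => /(_ isT).
(* Without 7, both 3 and 5 divide |G|, and [n 3] is not 7, so it is at least 10. *)
have [p7|np7] := boolP (piG 7); last first.
  have p5 : piG 5.
    have [p [pP np2 np3]] := third 2 3; have := small p pP.
    rewrite !inE (negbTE np2) (negbTE np3) /=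
      => /orP[] /eqP p_eq; subst p => //.
    by rewrite pP in np7.
  have p3 : piG 3.
    have [p [pP np2 np5]] := third 2 5; have := small p pP.
    rewrite !inE (negbTE np2) (negbTE np5) /=
      => /orP[] /eqP p_eq; subst p => //.
    by rewrite pP in np7.
  apply: (W2 5 3) => //; have [gt6 mod3 _] := nP 3 p3.
  have : (n 3 == 7) || (10 <= n 3) by move: (n 3) gt6 mod3; clear; lia.
  case/orP=> [/eqP n7|ge10].
    by case/negP: np7; apply: (n_piG 3) => //; rewrite n7.
  exact: leq_trans (leq_add (n5 p5) ge10).
have [gt6 mod7 _] := nP 7 p7.
have : [|| n 7 == 8, n 7 == 15 | 18 <= n 7] by move: (n 7) gt6 mod7; clear; lia.
case/or3P=> [/eqP n8|/eqP n15|]; last exact: W1.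
  have p2 : piG 2 by apply: (n_piG 7) => //; rewrite n8.
  have [gt2 _ _] := nP 2 p2.
  have [p5|np5] := boolP (piG 5).
    apply: (W3 7 5 2) => //; rewrite n8.
    exact: leq_trans (leq_add (leq_add (leqnn 8) (n5 p5)) gt2).
  have p3 : piG 3.
    have [p [pP np2 np7]] := third 2 7; have := small p pP.
    rewrite !inE (negbTE np2) (negbTE np7) /= orbF
      => /orP[] /eqP p_eq; subst p => //.
    by rewrite pP in np5.
  have [gt3 mod3 _] := nP 3 p3.
  have : [|| n 3 == 7, n 3 == 10, n 3 == 13 | 16 <= n 3].
    by move: (n 3) gt3 mod3; clear; lia.
  case/or4P=> [/eqP n3|/eqP n3|/eqP n3|ge16].
  (* Here 8 and 7 are coprime Sylow numbers for 7 and 3, which would force 3 to divide 8. *)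
  - have /andP[_ d3] := p3; have /andP[_ d7] := p7.
    have := @prime_dvd_card_Syl_coprime _ _ simpleG nsolG 7 3 isT isT d7 d3.
    by rewrite -/(n 7) -/(n 3) n8 n3 => /(_ isT).
  - by case/negP: np5; apply: (n_piG 3) => //; rewrite n3.
  - by have := n_small 3 13 p3 isT; rewrite n3 => /(_ isT).
  apply: (W3 7 3 2) => //; rewrite n8.
  exact: leq_trans (leq_add (leq_add (leqnn 8) ge16) gt2).
have p5 : piG 5 by apply: (n_piG 7) => //; rewrite n15.
apply: (W2 7 5) => //; rewrite n15.
exact: leq_trans (leq_add (leqnn 15) (n5 p5)).
Qed.

End LargeIndex.

Lemma minimal_simple_kprime_le : 59 * kprime G <= 9 * #|subgroups G|.
Proof.
have [/existsP[H /andP[prH le6]]|/existsPn large] :=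
  boolP [exists H : {group gT}, (H \proper G) && (#|G : H| <= 6)].
  have oG := card60_of_small_index prH le6.
  by have [-> ->] := simple60_counts simpleG oG.
apply: kprime_le_large_index => H prH.
by have := large H; rewrite prH -ltnNge.
Qed.

End MinimalSimple.

(* A minimal nonsolvable subgroup H of G has a simple quotient H / N with all
   proper subgroups solvable, so no isomorphism invariance of d' is needed. *)
Lemma nonsolvable_dstar_le (gT : finGroupType) (G : {group gT}) :
  ~~ solvable G -> (dstar G <= 9%:R / 59%:R)%R.
Proof.
move=> nsolG.
have [H /mingroupP[nsolH minH] sHG] :=
  @mingroup_exists _ (fun K : {group gT} => ~~ solvable K) _ nsolG.
have ntH : H :!=: 1 by apply: contraNneq nsolH => ->; apply: solvable1.
have [N maxN] := ex_maxnormal_ntrivg ntH; have nsNH := maxnormal_normal maxN.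
have solH (K : {group gT}) : K \proper H -> solvable K.
  case/andP=> sKH ltK; apply: contraR ltK => nsolK.
  by rewrite (minH K nsolK sKH).
have solN := solH N (maxnormal_proper maxN).
have simHN : simple (H / N)%G by rewrite quotient_simple.
have nsolHN : ~~ solvable (H / N)%G by rewrite (series_sol nsNH) solN in nsolH.
have solHN (K : {group coset_of N}) : K \proper (H / N)%G -> solvable K.
  case/andP=> sKHN prK; have [L defK sNL sLH] := inv_quotientS nsNH sKHN.
  rewrite defK quotient_sol // solH // properE sLH.
  by apply: contra prK => sHL; rewrite defK quotientS.
apply: le_trans (dstar_min sHG nsNH) _; rewrite dprime_le_ratio //.
exact: minimal_simple_kprime_le.
Qed.

Theorem mainTheorem1 :
  [/\ dstar ('Alt_('I_5))%G = (9%:R / 59%:R)%R,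
      dprime ('Alt_('I_5))%G = (9%:R / 59%:R)%R
    & forall (gT : finGroupType) (G : {group gT}),
        (9%:R / 59%:R < dstar G)%R -> solvable G].
Proof.
have [simA oA] := simple_Alt_I5; split.
- exact: dstar_simple60.
- exact: dprime_simple60.
move=> gT G ltG; apply: contraT => /nonsolvable_dstar_le.
by rewrite leNgt ltG.
Qed.
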